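(* Let $p$ be an odd prime, $G=\langle a,b : (a[b,a])^p,\ b^p\rangle$ and $H = G/\bigcap_{k\ge1}\gamma_k(G)$. Then $H$ is a para-$(C_p*C_p)$ group of Type III; in particular $H$ is residually nilpotent, $H/\gamma_i(H)\cong (C_p*C_p)/\gamma_i(C_p*C_p)$ for all $i\geq1$, and $H\not\cong C_p*C_p$.
   Context: Commutator convention: $[x,y]=x^{-1}y^{-1}xy$. $C_p*C_p=\langle a,b:a^p,b^p\rangle$. Lower central series: $\gamma_1(G)=G$, $\gamma_k(G)=[G,\gamma_{k-1}(G)]$; residually nilpotent means $\bigcap_k\gamma_k=\{1\}$. A group $G$ is weakly para-$\Gamma$ if $G/\gamma_k(G)\cong\Gamma/\gamma_k(\Gamma)$ for all $k$, and para-$\Gamma$ if moreover residually nilpotent. For $G=F/N$ weakly para-$\Gamma$ with $F$ free of rank $\mathrm{rk}(\Gamma)$ and $\Gamma=F/K$: $G$ is of Type I if some automorphism $\phi$ of $F$ has $\phi(N)\ge K$; of Type II if some automorphism $\phi$ of $F$ has $\phi(N)\lneq K$; of Type III otherwise. *)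

(* Defs.v *)
(* The free group F of rank 2 on a, b is
   implemented concretely as the type of freely reduced words. *)
From mathcomp Require Import all_boot.
Set Implicit Arguments. Unset Strict Implicit. Unset Printing Implicit Defensive.

(* A letter (g, e): generator g (false = a, true = b), e = true means inverse. *)
Definition letter := (bool * bool)%type.
Definition linv (x : letter) : letter := (x.1, ~~ x.2).

Fixpoint reduced (w : seq letter) : bool :=
  match w with
  | x :: ((y :: _) as t) => (y != linv x) && reduced t
  | _ => true
  end.

Definition push (x : letter) (w : seq letter) : seq letter :=
  match w with
  | y :: t => if y == linv x then t else x :: w
  | [::] => [:: x]
  end.

Definition norm (s : seq letter) : seq letter := foldr push [::] s.

Lemma push_reduced x w : reduced w -> reduced (push x w).
Proof.
case: w => [|y t] //= Hr.
case: eqP => [_|ne].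
- by case: t Hr => //= z s /andP[].
- by apply/andP; split; [apply/eqP | exact: Hr].
Qed.

Lemma norm_reduced s : reduced (norm s).
Proof. by elim: s => //= x s IH; apply: push_reduced. Qed.

Definition F2 := {w : seq letter | reduced w}.

Definition one : F2 := exist _ [::] isT.
Definition mul (x y : F2) : F2 :=
  exist _ (norm (val x ++ val y)) (norm_reduced _).
Definition inv (x : F2) : F2 :=
  exist _ (norm (rev (map linv (val x)))) (norm_reduced _).
Definition gen_a : F2 := exist _ [:: (false, false)] isT.
Definition gen_b : F2 := exist _ [:: (true, false)] isT.

Definition pow (x : F2) (n : nat) : F2 := iter n (mul x) one.
Definition comm (x y : F2) : F2 := mul (mul (inv x) (inv y)) (mul x y).
Definition conj (x g : F2) : F2 := mul (mul (inv g) x) g.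

Inductive sgen (R : F2 -> Prop) : F2 -> Prop :=
  | sgen_in x : R x -> sgen R x
  | sgen_one : sgen R one
  | sgen_mul x y : sgen R x -> sgen R y -> sgen R (mul x y)
  | sgen_inv x : sgen R x -> sgen R (inv x).

Inductive ncl (R : F2 -> Prop) : F2 -> Prop :=
  | ncl_in x : R x -> ncl R x
  | ncl_one : ncl R one
  | ncl_mul x y : ncl R x -> ncl R y -> ncl R (mul x y)
  | ncl_inv x : ncl R x -> ncl R (inv x)
  | ncl_conj x g : ncl R x -> ncl R (conj x g).

(* lcs0 n = gamma_{n+1}(F) *)
Fixpoint lcs0 (n : nat) : F2 -> Prop :=
  match n with
  | 0 => fun _ => True
  | n'.+1 => sgen (fun z => exists x y, z = comm x y /\ lcs0 n' y)
  end.
Definition gammaF (k : nat) : F2 -> Prop := lcs0 k.-1.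

(* For a normal subgroup A of F: preimage in F of gamma_k(F/A), i.e. gamma_k(F) A *)
Definition gammaQ (A : F2 -> Prop) (k : nat) : F2 -> Prop :=
  sgen (fun x => gammaF k x \/ A x).

(* preimage in F of the intersection of all gamma_k(F/A), k >= 1 *)
Definition gammaInf (A : F2 -> Prop) : F2 -> Prop :=
  fun x => forall k, 1 <= k -> gammaQ A k x.

(* F/A is isomorphic to F/B (A, B normal subgroups of F): there is a map
   F -> F inducing a well-defined bijective homomorphism F/A -> F/B. *)
Definition quot_iso (A B : F2 -> Prop) : Prop :=
  exists f : F2 -> F2,
    (forall x y, A (mul (inv x) y) <-> B (mul (inv (f x)) (f y))) /\
    (forall x y, B (mul (inv (mul (f x) (f y))) (f (mul x y)))) /\
    (forall z, exists x, B (mul (inv (f x)) z)).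

Definition res_nilp (A : F2 -> Prop) : Prop :=
  forall x, gammaInf A x -> A x.

Definition weakly_para (A B : F2 -> Prop) : Prop :=
  forall k, 1 <= k -> quot_iso (gammaQ A k) (gammaQ B k).
Definition para (A B : F2 -> Prop) : Prop := weakly_para A B /\ res_nilp A.

Definition automorphism (phi : F2 -> F2) : Prop :=
  (forall x y, phi (mul x y) = mul (phi x) (phi y)) /\ bijective phi.

Definition image (phi : F2 -> F2) (A : F2 -> Prop) : F2 -> Prop :=
  fun y => exists2 x, A x & phi x = y.

Definition subset (A B : F2 -> Prop) : Prop := forall x, A x -> B x.
Definition psubset (A B : F2 -> Prop) : Prop :=
  subset A B /\ exists x, B x /\ ~ A x.

(* Types, for G = F/N weakly para-Gamma with Gamma = F/K *)
Definition typeI (N K : F2 -> Prop) : Prop :=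
  exists phi, automorphism phi /\ subset K (image phi N).
Definition typeII (N K : F2 -> Prop) : Prop :=
  exists phi, automorphism phi /\ psubset (image phi N) K.
Definition typeIII (N K : F2 -> Prop) : Prop :=
  weakly_para N K /\ ~ typeI N K /\ ~ typeII N K.

(* K: kernel of F -> C_p * C_p = <a, b : a^p, b^p> *)
Definition K_free (p : nat) : F2 -> Prop :=
  ncl (fun r => r = pow gen_a p \/ r = pow gen_b p).
(* N: kernel of F -> G = <a, b : (a[b,a])^p, b^p> *)
Definition N_G (p : nat) : F2 -> Prop :=
  ncl (fun r => r = pow (mul gen_a (comm gen_b gen_a)) p \/ r = pow gen_b p).
(* M: kernel of F -> H = G / (intersection of gamma_k(G)) *)
Definition M_H (p : nat) : F2 -> Prop := gammaInf (N_G p).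

(* Main.v *)
From HB Require Import structures.
From mathcomp Require Import all_boot all_algebra ring.
Require Import Defs.
Set Implicit Arguments. Unset Strict Implicit. Unset Printing Implicit Defensive.
Import GRing.Theory.

(** The endomorphism [psi] of [F], [a |-> a[b,a]], [b |-> b], is invertible modulo every
    term of the lower central series, which identifies the nilpotent quotients of [H] with
    those of [C_p * C_p].

    [C_p * C_p] is represented by [rho] in [SL_2(F_p[t])] through [1 + t E_12] and
    [1 + t E_21].  Suppose that a morphism with values in [rho F] sends [a], [b] to [z], [y]
    and kills [N_G p].  Then [x = z[y,z]] and [y] have order dividing [p], hence trace [2],
    and [y^-1 z y = z x^-1 z] gives [T = T U - 2] with [T = tr z], [U = tr (x^-1 z)].
    So [T] divides [2] and is constant; as [T = 2] modulo [t], both [T] and [U] equal [2].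
    Then [tr [z,y] = 2], and with [tr z = tr y = 2] this makes all words in [z], [y] have
    trace [2], whereas [tr (rho (a b)) = 2 + t^2].  Thus no such morphism has [rho (a b)]
    in its image, which excludes [H = C_p * C_p] and Type II.

    For Type I, suppose [K <= phi(M)].  Then [theta o phi^-1], with [theta] an inverse of
    [psi] modulo a term of the lower central series, induces a surjective endomorphism of the
    corresponding quotient of [C_p * C_p] that kills [phi(M)].  Precomposition with it
    permutes the finitely many morphisms to the finite group [rho F] modulo [t^n], so [rho]
    modulo [t^n] kills [phi(M)] for all [n], and [rho o phi] is again excluded. *)

(** * Traces of 2 x 2 matrices *)

Section Matrix2.
Local Open Scope ring_scope.
Variable R : comNzRingType.
Implicit Types M N : 'M[R]_2.

Lemma ord2E (i : 'I_2) : i = 0 \/ i = 1.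
Proof. by case: i => [[|[|//]] Hi]; [left|right]; apply: val_inj. Qed.

Lemma lift01 : lift ord0 ord0 = 1 :> 'I_2. Proof. exact: val_inj. Qed.
Lemma ord00 : ord0 = 0 :> 'I_2. Proof. exact: val_inj. Qed.

Lemma mx2P M N : M 0 0 = N 0 0 -> M 0 1 = N 0 1 -> M 1 0 = N 1 0 ->
  M 1 1 = N 1 1 -> M = N.
Proof.
by move=> *; apply/matrixP => i j; case: (ord2E i) => ->; case: (ord2E j) => ->.
Qed.

Lemma mul2E M N i j : (M * N) i j = M i 0 * N 0 j + M i 1 * N 1 j.
Proof.
rewrite -[M * N]/(M *m N) mxE !big_ord_recl big_ord0 addr0.
by rewrite lift01 ord00.
Qed.

Lemma tr2E M : \tr M = M 0 0 + M 1 1.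
Proof.
by rewrite /mxtrace !big_ord_recl big_ord0 addr0 lift01 ord00.
Qed.

Lemma det2E M : \det M = M 0 0 * M 1 1 - M 0 1 * M 1 0.
Proof.
rewrite (expand_det_row M 0) !big_ord_recl big_ord0 addr0 lift01 ord00.
rewrite /cofactor !det_mx11 !mxE /= expr0 expr1 mul1r mulN1r mulrN.
by congr (M 0 0 * M _ _ - M 0 1 * M _ _); apply: val_inj.
Qed.

Lemma tr2M M N : \tr (M * N) = \tr (N * M).
Proof. exact: mxtrace_mulC. Qed.

(** Cayley-Hamilton; [anticomm2E] is its polarization. *)
Lemma sqr2E M : M * M = \tr M *: M - (\det M)%:M.
Proof.
by apply: mx2P; rewrite mul2E !mxE tr2E det2E /= ?mulr1n ?mulr0n; ring.
Qed.

Lemma anticomm2E M N :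
  M * N + N * M = \tr M *: N + \tr N *: M + (\tr (M * N) - \tr M * \tr N)%:M.
Proof.
by apply: mx2P; rewrite [LHS]mxE !tr2E !mul2E !mxE /= ?mulr1n ?mulr0n; ring.
Qed.

(* Fricke's formula: [\tr z - z] is the adjugate of [z], hence its inverse when [\det z = 1]. *)
Lemma tr_comm2E (z y : 'M[R]_2) :
  \tr (((\tr z)%:M - z) * ((\tr y)%:M - y) * z * y) =
  \tr z ^+ 2 * \det y + \tr y ^+ 2 * \det z + \tr (z * y) ^+ 2
  - \tr z * \tr y * \tr (z * y) - (\det z * \det y) *+ 2.
Proof. by rewrite !tr2E !det2E !mul2E !mxE /=; ring. Qed.

(** Multiply Cayley-Hamilton, [z * z = \tr z *: z - 1], by [z'] on the right. *)
Lemma sl2_inv (z z' : 'M[R]_2) : \det z = 1 -> z * z' = 1 -> z' = (\tr z)%:M - z.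
Proof.
move=> dz zz; have : z * z * z' = (\tr z *: z - 1) * z' by rewrite sqr2E dz.
rewrite -mulrA zz mulr1 mulrBl mul1r -scalerAl zz => {2}->.
by rewrite -[1]/(1%:M) scalemx1 opprB addrC subrK.
Qed.

End Matrix2.

(** * Unipotent matrices in characteristic [p] *)

Section Unipotent.
Local Open Scope ring_scope.
Variables (R : idomainType) (p : nat).
Hypothesis pR : p \in [pchar R].
Implicit Types M N x : 'M[R]_2.

Lemma pchar_mx2 : p \in [pchar 'M[R]_2].
Proof.
rewrite inE (pcharf_prime pR) /=; apply/eqP.
by rewrite -[p%:R]/((p%:R : 'M[R]_2)) -(raddfMn (@scalar_mx R 2) p 1) /= (pcharf0 pR) raddf0.
Qed.

(** Over a domain a nilpotent matrix has determinant [0], so by Cayley-Hamilton its positive powers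
    are [M] times powers of [\tr M]; taking traces leaves a power of [\tr M] equal to [0]. *)
Lemma nilp_tr0 M k : M ^+ k = 0 -> \tr M = 0.
Proof.
case: k => [/matrixP/(_ 0 0)|k Mk].
  by rewrite !mxE /= => /eqP; rewrite oner_eq0.
have d0 : \det M = 0.
  have : \det (M ^+ k.+1) = 0 by rewrite Mk det0.
  have -> : \det (M ^+ k.+1) = \det M ^+ k.+1.
    elim: (k.+1) => [|i IH]; first by rewrite !expr0 det1.
    by rewrite !exprS -IH -det_mulmx.
  by move/eqP; rewrite expf_eq0 => /andP[_ /eqP].
have Mi i : M ^+ i.+1 = \tr M ^+ i *: M.
  elim: i => [|i IH]; first by rewrite scale1r.
  rewrite exprSr IH -scalerAl sqr2E d0 raddf0 subr0 scalerA.
  by rewrite exprSr.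
move: Mk; rewrite Mi => /(congr1 mxtrace); rewrite mxtraceZ -exprSr mxtrace0.
by move/eqP; rewrite expf_eq0 => /andP[_ /eqP].
Qed.

(** Frobenius on the commuting pair [x], [1] turns [x ^+ p = 1] into nilpotency of [x - 1]. *)
Lemma tr_torsion x : x ^+ p = 1 -> \tr x = 2%:R.
Proof.
move=> xp; have : (x - 1) ^+ p = 0.
  have := pFrobenius_autB_comm pchar_mx2 (commr1 x).
  by rewrite !pFrobenius_autE xp expr1n subrr.
move/nilp_tr0; rewrite raddfB /= => /eqP; rewrite subr_eq0 => /eqP->.
by rewrite mxtrace1.
Qed.

Lemma unip_exp M : M * M = 0 -> (1 + M) ^+ p = 1.
Proof.
move=> MM; have := pFrobenius_autD_comm pchar_mx2 (commr_sym (commr1 M)).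
rewrite !pFrobenius_autE expr1n => ->.
by case: p (pcharf_prime pR) => [|[|q]] // _; rewrite !exprS mulrA MM mul0r addr0.
Qed.

End Unipotent.

(** * The equation [x = z[y,z]] with [x] and [y] of order dividing [p] *)

Section CommutatorEquation.
Local Open Scope ring_scope.
Variables (F : fieldType) (p : nat).
Hypothesis (pF : p \in [pchar F]) (oddp : odd p).
Let A := {poly F}.
Variables z z' y y' : 'M[A]_2.
Hypotheses (zz : z * z' = 1) (yy : y * y' = 1) (dz : \det z = 1) (dy : \det y = 1).
Hypothesis Tz : (\tr z).[0] = 2%:R.
Hypothesis yp : y ^+ p = 1.
Let x := z * (y' * z' * y * z).
Hypothesis xp : x ^+ p = 1.

Lemma two_neq0 : 2%:R != 0 :> F.
Proof.
rewrite -(dvdn_pcharf pF); apply: contraL oddp => p2.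
have := pcharf_prime pF; move: p2; rewrite dvdn_prime2 ?(pcharf_prime pF) //.
by move/eqP->.
Qed.

Let pA : p \in [pchar A]. Proof. by rewrite pchar_poly. Qed.

Let vz : z' * z = 1. Proof. by apply: mulmx1C. Qed.
Let vy : y' * y = 1. Proof. by apply: mulmx1C. Qed.

Lemma trz_tru : \tr z = 2%:R /\ \tr (z' * y' * z * y) = 2%:R.
Proof.
have ty : \tr y = 2%:R := tr_torsion pA yp.
have tx : \tr x = 2%:R := tr_torsion pA xp.
(* The inverse of [x]; it gives both [y^-1 z y = z x^-1 z] and [[z,y] = x^-1 z]. *)
pose x' := z' * y' * z * y * z'.
have dx : \det x = 1.
  rewrite /x !det_mulmx dz dy !mul1r !mulr1.
  have := congr1 determinant zz; have := congr1 determinant yy.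
  by rewrite !det_mulmx dz dy !mul1r !det1 => -> ->; rewrite mulr1.
have xx : x * x' = 1.
  rewrite /x /x' !mulrA -(mulrA _ z z') zz mulr1 -(mulrA _ y y') yy mulr1.
  by rewrite -(mulrA _ z' z) vz mulr1 -(mulrA _ y' y) vy mulr1.
have x'E := sl2_inv dx xx.
have tx' : \tr x' = 2%:R.
  by rewrite x'E tx raddfB /= mxtrace_scalar tx; ring.
have conj_z : y' * z * y = z * x' * z.
  by rewrite /x' !mulrA zz mul1r -(mulrA _ z' z) vz mulr1.
have uE : z' * y' * z * y = x' * z by rewrite /x' -(mulrA _ z' z) vz mulr1.
rewrite uE; set T := \tr z; set U := \tr (x' * z).
have TU : T = T * U - 2%:R.
  transitivity (\tr (y' * z * y)).
    by rewrite tr2M mulrA yy mul1r.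
  (* Cyclicity gives [\tr (x' * (z * z))], and Cayley-Hamilton replaces [z * z] by [T *: z - 1]. *)
  rewrite conj_z -mulrA tr2M -mulrA sqr2E dz mulrBr raddfB /= mulr1 tx'.
  by rewrite -scalerAr mxtraceZ.
have TU2 : T * (U - 1) = 2%:R by rewrite mulrBr mulr1 {2}TU; ring.
have two_unit : (2%:R : A) \is a GRing.unit.
  by rewrite -polyC_natr poly_unitE size_polyC coefC /= unitfE two_neq0.
(* [T] divides the unit [2], so it is a constant polynomial, determined by its value at [0]. *)
have T2 : T = 2%:R.
  have : T \is a GRing.unit.
    by apply/unitrPr; exists ((U - 1) / 2%:R); rewrite mulrA TU2 divrr.
  rewrite poly_unitE => /andP[/eqP/eq_leq/size1_polyC sT _].
  by rewrite sT -horner_coef0 Tz polyC_natr.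
split=> //; apply: (@mulrI _ _ two_unit).
move: TU; rewrite T2 => /(congr1 (+%R^~ 2%:R)); rewrite subrK => <-.
by ring.
Qed.

Let m := z - 1.
Let n := y - 1.

Lemma mn_rel : [/\ m * m = 0, n * n = 0 & n * m = - (m * n)] /\
  [/\ \tr m = 0, \tr n = 0 & \tr (m * n) = 0].
Proof.
have ty : \tr y = 2%:R := tr_torsion pA yp.
have [tz tu] := trz_tru.
have tm : \tr m = 0 by rewrite raddfB /= tz mxtrace1 subrr.
have tn : \tr n = 0 by rewrite raddfB /= ty mxtrace1 subrr.
have sq (w : 'M[A]_2) : \det w = 1 -> \tr w = 2%:R -> (w - 1) * (w - 1) = 0.
  move=> dw tw; rewrite mulrBl mul1r mulrBr mulr1 sqr2E dw tw.
  rewrite -[1%:M]/(1 : 'M[A]_2) scaler_nat mulr2n opprB.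
  by rewrite [_ - 1 - w]addrAC addrK addrA subrK subrr.
have tmn : \tr (m * n) = 0.
  (* As [z] and [y] have trace [2], Fricke's formula reads [\tr [z,y] - 2 = (\tr (z * y) - 2) ^+
     2]. *)
  move: tu; rewrite (sl2_inv dz zz) (sl2_inv dy yy) tr_comm2E dz dy tz ty => tu.
  have : (\tr (z * y) - 2%:R) ^+ 2 = 0 by rewrite -(subrr 2%:R) -{2}tu; ring.
  move/eqP; rewrite expf_eq0 /= subr_eq0 => /eqP tzy.
  rewrite mulrBl mul1r mulrBr mulr1 !raddfB /= tzy tz ty mxtrace1; ring.
split=> //; split; [exact: sq|exact: sq|].
(* All the traces on the right of the polarized Cayley-Hamilton identity vanish. *)
by apply/eqP; rewrite -addr_eq0 addrC anticomm2E tm tn tmn !scale0r mul0r subr0 raddf0 !addr0.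
Qed.

End CommutatorEquation.

(** * The free group of rank 2 *)

Lemma linvK : involutive linv.
Proof. by case=> g e; rewrite /linv /= negbK. Qed.

Lemma push_linvK x w : reduced w -> push (linv x) (push x w) = w.
Proof.
case: w => [_|y t] /=; first by rewrite linvK eqxx.
case: eqP => [-> |_ _] /=; last by rewrite linvK eqxx.
case: t => [|z t] //= /andP[nz _].
by rewrite (negbTE nz).
Qed.

Lemma foldr_push_reduced w s : reduced w -> reduced (foldr push w s).
Proof. by move=> rw; elim: s => //= x s; apply: push_reduced. Qed.

(** Van der Waerden's argument: letters act invertibly on reduced words, so cancelling pairs act
    trivially and a word acts as its normal form does. Associativity of [mul] follows. *)
Lemma foldr_push_norm w s : reduced w -> foldr push w (norm s) = foldr push w s.
Proof.
move=> rw; elim: s => //= x s <-; case: (norm s) => //= y t.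
case: eqP => //= ->.
by rewrite -{1}[x]linvK push_linvK ?linvK // foldr_push_reduced.
Qed.

Lemma norm_id w : reduced w -> norm w = w.
Proof.
elim: w => //= x [|y t] IH //= /andP[nyx rt].
by move: (IH rt) => /= ->; rewrite /= (negbTE nyx).
Qed.

Lemma val_mul (x y : F2) : val (mul x y) = foldr push (val y) (val x).
Proof. by rewrite /= /norm foldr_cat -/(norm _) (norm_id (valP y)). Qed.

Lemma foldr_push_rev w s :
  reduced w -> foldr push (foldr push w s) (rev (map linv s)) = w.
Proof.
elim: s w => //= x s IH w rw.
rewrite rev_cons foldr_rcons push_linvK ?IH //.
exact: foldr_push_reduced.
Qed.

Lemma mulF2A : associative mul.
Proof.
move=> x y z; apply: val_inj; rewrite (val_mul x) (val_mul y) (val_mul (mul x y)) /=.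
by rewrite foldr_push_norm ?foldr_cat ?(valP z).
Qed.

Lemma mul1F2 : left_id one mul.
Proof. by move=> x; apply: val_inj; rewrite val_mul. Qed.

Lemma mulF21 : right_id one mul.
Proof. by move=> x; apply: val_inj; rewrite val_mul; apply: norm_id (valP x). Qed.

Lemma mulVF2 : left_inverse one inv mul.
Proof.
move=> x; apply: val_inj; rewrite val_mul /= foldr_push_norm ?(valP x) //.
by rewrite -{1}(norm_id (valP x)) foldr_push_rev.
Qed.

Lemma mulF2V : right_inverse one inv mul.
Proof.
move=> x; have := mulVF2 (inv x).
rewrite -{2}[inv x]mulF21 -(mulVF2 x) => e.
by rewrite -[LHS]mul1F2 -{1}(mulVF2 (inv x)) -!mulF2A [mul (inv x) _]mulF2A mulVF2 mul1F2 mulVF2.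
Qed.

HB.instance Definition _ := Choice.copy F2 {w : seq letter | reduced w}.
HB.instance Definition _ := isGroup.Build F2
  mulF2A mul1F2 mulF21 mulVF2 mulF2V.

Section FreeGroup.
Local Open Scope group_scope.

Lemma commE (x y : F2) : comm x y = [~ x, y].
Proof. by rewrite /commg /conjg !mulgA; apply: mulgA. Qed.

Lemma conjE (x g : F2) : conj x g = x ^ g.
Proof. by rewrite /conjg mulgA. Qed.

Lemma powE (x : F2) n : pow x n = x ^+ n.
Proof. exact: iter_mulg_1. Qed.

Lemma F2_gen_ind (P : F2 -> Prop) :
  P 1 ->
  (forall x, P x -> P (gen_a * x)) -> (forall x, P x -> P (gen_a^-1 * x)) ->
  (forall x, P x -> P (gen_b * x)) -> (forall x, P x -> P (gen_b^-1 * x)) ->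
  forall x, P x.
Proof.
move=> P1 Pa PaV Pb PbV [w rw]; elim: w rw => [|[g e] w IH] rw.
  by rewrite (_ : exist _ _ _ = 1 :> F2) //; apply: val_inj.
have rw' : reduced w by case: w rw {IH} => //= y t /andP[].
have push_w : push (g, e) w = (g, e) :: w.
  by case: w rw {IH rw'} => //= y t /andP[/negbTE->].
have -> : exist _ ((g, e) :: w) rw =
    (exist _ [:: (g, e)] isT : F2) * exist _ w rw'.
  by apply: val_inj; rewrite [RHS]val_mul /= push_w.
case: g e {push_w rw} => [] [];
  [move/PbV: (IH rw') | move/Pb: (IH rw') | move/PaV: (IH rw') | move/Pa: (IH rw')];
  by congr (P (_ * _)); apply: val_inj.
Qed.

(** * Morphisms out of the free group *)

Section Evaluation.
Variables (M : Type) (e : M) (op : Monoid.law e).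
Variable m : letter -> M.
Hypothesis m_linv : forall l, op (m l) (m (linv l)) = e.

(** The target is a monoid, so that the multiplicative monoid of a matrix ring can serve. *)
Definition evalF2 (x : F2) : M := \big[op/e]_(l <- val x) m l.

Lemma big_push l w :
  \big[op/e]_(i <- push l w) m i = op (m l) (\big[op/e]_(i <- w) m i).
Proof.
case: w => [|y t] /=; first by rewrite !big_cons.
case: eqP => [->|_]; last by rewrite !big_cons.
rewrite big_cons Monoid.mulmA; apply/esym.
exact: etrans (congr1 (op^~ _) (m_linv l)) (Monoid.mul1m op _).
Qed.

Lemma evalF2M (x y : F2) : evalF2 (x * y) = op (evalF2 x) (evalF2 y).
Proof.
rewrite /evalF2 [val (x * y)]val_mul.
elim: (val x) => [|l s IH] /=; first by rewrite big_nil Monoid.mul1m.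
by rewrite big_push IH big_cons Monoid.mulmA.
Qed.

Lemma evalF21 : evalF2 1 = e.
Proof. exact: big_nil. Qed.

End Evaluation.

Lemma F2_hom_eq (M : Type) (e : M) (op : Monoid.law e) (h h' : F2 -> M) :
  {morph h : x y / x * y >-> op x y} -> {morph h' : x y / x * y >-> op x y} ->
  h 1 = e -> h' 1 = e ->
  h gen_a = h' gen_a -> h gen_b = h' gen_b -> h =1 h'.
Proof.
move=> hM h'M h1 h'1 ea eb.
(* Inverses in a monoid are unique, so agreement at [g] forces agreement at [g^-1]. *)
have eV g : h g = h' g -> h g^-1 = h' g^-1.
  move=> eg; transitivity (op (h g^-1) (h' (g * g^-1))).
    by rewrite mulgV h'1 Monoid.mulm1.
  rewrite h'M -eg; transitivity (op (op (h g^-1) (h g)) (h' g^-1)).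
    exact: Monoid.mulmA.
  by rewrite -hM mulVg h1 Monoid.mul1m.
by apply: F2_gen_ind => [|x IH|x IH|x IH|x IH];
  rewrite ?h1 ?h'1 // hM h'M IH ?eV ?ea ?eb.
Qed.

Definition endoF2 (u v : F2) : F2 -> F2 :=
  evalF2 ( *%g : Monoid.law (1 : F2))
    (fun l => let g := if l.1 then v else u in if l.2 then g^-1 else g).

Lemma endoF2M u v : {morph endoF2 u v : x y / x * y}.
Proof.
by move=> x y; apply: evalF2M => -[g []] /=; rewrite ?mulgV ?mulVg.
Qed.

Lemma endoF2a u v : endoF2 u v gen_a = u.
Proof. by rewrite /endoF2 /evalF2 big_seq1. Qed.

Lemma endoF2b u v : endoF2 u v gen_b = v.
Proof. by rewrite /endoF2 /evalF2 big_seq1. Qed.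

Section Morphisms.
Variable h : F2 -> F2.
Hypothesis hM : {morph h : x y / x * y}.

Lemma morphF21 : h 1 = 1.
Proof. by apply: (mulgI (h 1)); rewrite -hM !mulg1. Qed.

Lemma morphF2V : {morph h : x / x^-1}.
Proof. by move=> x; apply: (mulgI (h x)); rewrite -hM !mulgV morphF21. Qed.

Lemma morphF2J : {morph h : x y / x ^ y}.
Proof. by move=> x y; rewrite /conjg !hM morphF2V. Qed.

Lemma morphF2R : {morph h : x y / [~ x, y]}.
Proof. by move=> x y; rewrite !commgEl /conjg !hM !morphF2V. Qed.

Lemma morphF2X n : {morph h : x / x ^+ n}.
Proof. by move=> x; elim: n => [|n IH]; rewrite ?morphF21 // !expgS hM IH. Qed.

End Morphisms.

(** * Normal subgroups and the lower central series *)

Record normal_sub (A : F2 -> Prop) : Prop := NormalSub {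
  nsub1 : A 1;
  nsubM : forall x y, A x -> A y -> A (x * y);
  nsubV : forall x, A x -> A x^-1;
  nsubJ : forall x g, A x -> A (x ^ g)
}.

Lemma sgen_sub R A : normal_sub A -> (forall x, R x -> A x) ->
  forall x, sgen R x -> A x.
Proof.
move=> nA RA x; elim=> {x} [x /RA //||x y _ Ax _ Ay|x _ Ax].
- exact: nsub1 nA.
- exact: (nsubM nA).
- exact: (nsubV nA).
Qed.

Lemma ncl_sub R A : normal_sub A -> (forall x, R x -> A x) ->
  forall x, ncl R x -> A x.
Proof.
move=> nA RA x; elim=> {x} [x /RA //||x y _ Ax _ Ay|x _ Ax|x g _ Ax].
- exact: nsub1 nA.
- exact: (nsubM nA).
- exact: (nsubV nA).
- by rewrite conjE; apply: (nsubJ nA).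
Qed.

Lemma ncl_normal R : normal_sub (ncl R).
Proof.
split=> [|x y|x|x g]; first exact: ncl_one.
- exact: ncl_mul.
- exact: ncl_inv.
- by rewrite -conjE; apply: ncl_conj.
Qed.

Lemma sgen_normal (R : F2 -> Prop) :
  (forall x g, R x -> R (x ^ g)) -> normal_sub (sgen R).
Proof.
move=> RJ; split=> [|x y|x|x g]; first exact: sgen_one.
- exact: sgen_mul.
- exact: sgen_inv.
elim=> {x} [x Rx||x y _ Sx _ Sy|x _ Sx].
- exact/sgen_in/RJ.
- by rewrite conj1g; apply: sgen_one.
- by rewrite [mul x y]/(x * y) conjMg; apply: sgen_mul.
- by rewrite [inv x]/(x^-1) conjVg; apply: sgen_inv.
Qed.

Lemma preim_normal (h : F2 -> F2) A :
  {morph h : x y / x * y} -> normal_sub A -> normal_sub (fun x => A (h x)).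
Proof.
move=> hM nA; split=> [|x y|x|x g].
- by rewrite morphF21 //; apply: nsub1.
- by rewrite hM; apply: nsubM.
- by rewrite morphF2V //; apply: nsubV.
- by rewrite morphF2J //; apply: nsubJ.
Qed.

Lemma lcs0_normal n : normal_sub (lcs0 n).
Proof.
elim: n => [|n IH] //; apply: sgen_normal => z g [x [y [-> yn]]].
exists (x ^ g), (y ^ g); split; first by rewrite !commE conjRg.
exact: (nsubJ IH).
Qed.

Lemma lcs0R n x y : lcs0 n y -> lcs0 n.+1 [~ x, y].
Proof. by move=> yn; apply: sgen_in; exists x, y; rewrite commE. Qed.

Lemma lcs0_hom h n x : {morph h : x y / x * y} -> lcs0 n x -> lcs0 n (h x).
Proof.
move=> hM; elim: n x => [|n IH] x //=.
apply: (sgen_sub (preim_normal hM (lcs0_normal n.+1))).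
by move=> z [y [t [-> /IH]]]; rewrite commE morphF2R //; apply: lcs0R.
Qed.

Lemma lcs0S n x : lcs0 n.+1 x -> lcs0 n x.
Proof.
elim: n x => [|n IH] x // xn.
apply: (sgen_sub (lcs0_normal n.+1)) xn => z [y [t [-> /IH tn]]].
by rewrite commE; apply: lcs0R.
Qed.

Lemma lcs0_le m n x : m <= n -> lcs0 n x -> lcs0 m x.
Proof. by move/subnK <-; elim: (n - m)%N => [|i IH] // /lcs0S. Qed.

(** * Congruence modulo a normal subgroup *)

Definition cong (A : F2 -> Prop) (x y : F2) := A (x^-1 * y).

Section Congruence.
Variable A : F2 -> Prop.
Hypothesis nA : normal_sub A.

Lemma cong_refl x : cong A x x.
Proof. by rewrite /cong mulVg; apply: nsub1. Qed.

Lemma cong_sym x y : cong A x y -> cong A y x.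
Proof. by move/(nsubV nA); rewrite invgM invgK. Qed.

Lemma cong_trans x y z : cong A x y -> cong A y z -> cong A x z.
Proof. by move=> xy /(nsubM nA xy); rewrite -mulgA mulVKg. Qed.

Lemma congM x x' y y' : cong A x x' -> cong A y y' -> cong A (x * y) (x' * y').
Proof.
rewrite /cong => /(nsubJ nA y) xx yy; move: (nsubM nA xx yy).
by rewrite /conjg invgM !mulgA mulgK.
Qed.

Lemma congV x x' : cong A x x' -> cong A x^-1 x'^-1.
Proof.
rewrite /cong => /(nsubV nA)/(nsubJ nA x^-1).
by rewrite /conjg invgM !invgK !mulgA mulgK.
Qed.

Lemma congX n x x' : cong A x x' -> cong A (x ^+ n) (x' ^+ n).
Proof.
move=> xx; elim: n => [|n IH]; first exact: cong_refl.
by rewrite !expgS; apply: congM.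
Qed.

Lemma cong_sub x y : cong A x y -> A x -> A y.
Proof. by move=> xy Ax; move: (nsubM nA Ax xy); rewrite mulVKg. Qed.

Lemma cong_endo h h' :
  {morph h : x y / x * y} -> {morph h' : x y / x * y} ->
  cong A (h gen_a) (h' gen_a) -> cong A (h gen_b) (h' gen_b) ->
  forall x, cong A (h x) (h' x).
Proof.
move=> hM h'M ca cb.
by apply: F2_gen_ind => [|x IH|x IH|x IH|x IH];
  rewrite ?(morphF21 hM) ?(morphF21 h'M) ?hM ?h'M ?(morphF2V hM)
    ?(morphF2V h'M) //; try apply: cong_refl; apply: congM => //; apply: congV.
Qed.

End Congruence.

(** * Inverting [psi] modulo the lower central series *)

Lemma lcs0_commr n b z w :
  cong (lcs0 n) z w -> cong (lcs0 n.+1) [~ b, z] [~ b, w].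
Proof.
rewrite /cong; set c := z^-1 * w => cn.
have -> : w = z * c by rewrite mulVKg.
have nn := lcs0_normal n.+1.
(* Follows from [[b,zc] = [b,c] [b,z]^c]. Up to conjugation both factors are commutators with [c],
   which gains one step of the series and makes the map [z |-> a [b,z]^-1] contracting. *)
have -> : [~ b, z]^-1 * [~ b, z * c] = [~ b, c] ^ [~ b, z] * [~ [~ b, z], c].
  rewrite !commgEr /conjg !invgM !invgK -!mulgA; do ! rewrite ?mulKg ?mulVKg.
  by [].
by apply: (nsubM nn); [apply: nsubJ => // |]; apply: lcs0R.
Qed.

(* Fixed-point iteration for [z [b, z] = a]; the error of the n-th iterate lies in [lcs0 n]. *)
Fixpoint approx_sol (n : nat) : F2 :=
  if n is n'.+1 then gen_a * [~ gen_b, approx_sol n']^-1 else gen_a.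

Lemma approx_sol_step n : cong (lcs0 n) (approx_sol n) (approx_sol n.+1).
Proof.
elim: n => [|n IH] //; have nn := lcs0_normal n.+1.
exact/(congM nn (cong_refl nn _))/(congV nn)/lcs0_commr.
Qed.

Lemma approx_solP n :
  cong (lcs0 n) (approx_sol n * [~ gen_b, approx_sol n]) gen_a.
Proof.
have nn := lcs0_normal n.
(* Exact by the recursion; it remains to compare two successive iterates. *)
have -> : gen_a = approx_sol n.+1 * [~ gen_b, approx_sol n] by rewrite /= mulgVK.
exact: (congM nn (approx_sol_step n) (cong_refl nn _)).
Qed.

(** Bootstrapping: agreement modulo [lcs0 m] makes the commutators with [b] agree modulo
    [lcs0 m.+1], hence [z] and [w] too as long as [m < n]. *)
Lemma sol_uniq n z w :
  cong (lcs0 n) (z * [~ gen_b, z]) (w * [~ gen_b, w]) -> cong (lcs0 n) z w.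
Proof.
move=> zw; suff: forall m, m <= n -> cong (lcs0 m) z w by apply.
elim=> [|m IH] mn //; have nm := lcs0_normal m.+1.
rewrite -(mulgK [~ gen_b, z] z) -(mulgK [~ gen_b, w] w).
apply: (congM nm); first exact: lcs0_le zw.
exact/(congV nm)/lcs0_commr/IH/ltnW.
Qed.

Definition psi : F2 -> F2 := endoF2 (gen_a * [~ gen_b, gen_a]) gen_b.
Definition theta (n : nat) : F2 -> F2 := endoF2 (approx_sol n) gen_b.

Lemma psiM : {morph psi : x y / x * y}. Proof. exact: endoF2M. Qed.
Lemma thetaM n : {morph theta n : x y / x * y}. Proof. exact: endoF2M. Qed.

Lemma psi_a : psi gen_a = gen_a * [~ gen_b, gen_a]. Proof. exact: endoF2a. Qed.
Lemma psi_b : psi gen_b = gen_b. Proof. exact: endoF2b. Qed.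
Lemma theta_a n : theta n gen_a = approx_sol n. Proof. exact: endoF2a. Qed.
Lemma theta_b n : theta n gen_b = gen_b. Proof. exact: endoF2b. Qed.

Lemma theta_psi n x : cong (lcs0 n) (theta n (psi x)) x.
Proof.
have nn := lcs0_normal n.
apply: (cong_endo nn (h := fun x => theta n (psi x)) (h' := id)) => //.
- by move=> y z; rewrite psiM thetaM.
- rewrite psi_a thetaM (morphF2R (@thetaM n)) theta_a theta_b.
  exact: approx_solP.
- by rewrite psi_b theta_b; apply: cong_refl.
Qed.

Lemma psi_theta n x : cong (lcs0 n) (psi (theta n x)) x.
Proof.
have nn := lcs0_normal n.
apply: (cong_endo nn (h := fun x => psi (theta n x)) (h' := id)) => //.
- by move=> y z; rewrite thetaM psiM.
(* Both [psi (approx_sol n)] and [a] solve [w [b,w] = a [b,a]] modulo [lcs0 n]. *)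
- rewrite theta_a; apply: sol_uniq.
  have -> : psi (approx_sol n) * [~ gen_b, psi (approx_sol n)] =
            psi (approx_sol n * [~ gen_b, approx_sol n]).
    by rewrite psiM (morphF2R psiM) psi_b.
  rewrite -psi_a /cong -(morphF2V psiM) -psiM; apply: (lcs0_hom psiM).
  exact: approx_solP.
- by rewrite theta_b psi_b; apply: cong_refl.
Qed.

(** * Nilpotent quotients of [F/A] *)

Section LowerCentralQuotients.
Variables (A : F2 -> Prop) (k : nat).
Hypothesis nA : normal_sub A.

Lemma gammaQ_normal : normal_sub (gammaQ A k).
Proof.
apply: sgen_normal => x g [xk|Ax]; [left|right].
  exact: (nsubJ (lcs0_normal _)).
exact: nsubJ.
Qed.

Lemma gammaQ_lcs x : lcs0 k.-1 x -> gammaQ A k x.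
Proof. by move=> xk; apply: sgen_in; left. Qed.

Lemma gammaQ_in x : A x -> gammaQ A k x.
Proof. by move=> Ax; apply: sgen_in; right. Qed.

Lemma gammaQ_hom B h : {morph h : x y / x * y} ->
  (forall x, B x -> gammaQ A k (h x)) -> forall x, gammaQ B k x -> gammaQ A k (h x).
Proof.
move=> hM hB; apply: (sgen_sub (preim_normal hM gammaQ_normal)) => x [xk|/hB//].
exact/gammaQ_lcs/lcs0_hom.
Qed.

End LowerCentralQuotients.

Lemma gammaInf_normal A : normal_sub A -> normal_sub (gammaInf A).
Proof.
move=> nA; split=> [k k0|x y Ax Ay k k0|x Ax k k0|x g Ax k k0];
  have nk := gammaQ_normal k nA.
- exact: nsub1 nk.
- by apply: (nsubM nk); [apply: Ax|apply: Ay].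
- by apply: (nsubV nk); apply: Ax.
- by apply: (nsubJ nk); apply: Ax.
Qed.

Lemma gammaInf_in A x : A x -> gammaInf A x.
Proof. by move=> Ax k _; apply: gammaQ_in. Qed.

(** The intersection lies in every [gammaQ A k], so enlarging [A] to it changes no nilpotent
    quotient. Residual nilpotence of [H] is a consequence. *)
Lemma gammaQ_gammaInf A k x : normal_sub A -> 1 <= k ->
  gammaQ (gammaInf A) k x <-> gammaQ A k x.
Proof.
move=> nA k0; split.
  apply: (sgen_sub (gammaQ_normal k nA)) => y [yk|]; first exact: gammaQ_lcs.
  by apply.
have nI := gammaQ_normal k (gammaInf_normal nA).
apply: (sgen_sub nI) => y [yk|Ay]; first exact: gammaQ_lcs.
exact/gammaQ_in/gammaInf_in.
Qed.

Lemma gammaInf_res_nilp A : normal_sub A -> res_nilp (gammaInf A).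
Proof. by move=> nA x Ix k k0; apply/(gammaQ_gammaInf _ nA k0)/Ix. Qed.

(** * Comparing the quotients of [H] and [C_p * C_p] *)

Section Presentations.
Variable p : nat.

Lemma K_normal : normal_sub (K_free p). Proof. exact: ncl_normal. Qed.
Lemma N_normal : normal_sub (N_G p). Proof. exact: ncl_normal. Qed.
Lemma M_normal : normal_sub (M_H p). Proof. exact: gammaInf_normal N_normal. Qed.

Lemma psi_K x : K_free p x -> N_G p (psi x).
Proof.
apply: (ncl_sub (preim_normal psiM N_normal)) => _ [] ->;
  rewrite powE (morphF2X psiM) ?psi_a ?psi_b; apply: ncl_in.
- by left; rewrite powE -commE.
- by right; rewrite powE.
Qed.

Lemma theta_N k x : N_G p x -> gammaQ (K_free p) k (theta k.-1 x).
Proof.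
have tM := @thetaM k.-1; have nQ := gammaQ_normal k K_normal.
apply: (ncl_sub (preim_normal tM nQ)) => _ [] ->; rewrite powE (morphF2X tM).
(* Modulo [lcs0 k.-1], [theta] sends [a[b,a]] to [a], hence the first relator to [a ^+ p]. *)
- rewrite [mul _ _]/(gen_a * _) commE tM (morphF2R tM) theta_a theta_b.
  apply: (@cong_sub _ nQ (gen_a ^+ p)); last first.
    by apply/gammaQ_in/ncl_in; left; rewrite powE.
  apply/(congX nQ)/(cong_sym nQ)/gammaQ_lcs/approx_solP.
- by rewrite theta_b; apply/gammaQ_in/ncl_in; right; rewrite powE.
Qed.

Lemma theta_M k x : 1 <= k -> M_H p x -> gammaQ (K_free p) k (theta k.-1 x).
Proof.
move=> k0 /(_ k k0); apply: (gammaQ_hom K_normal (@thetaM _)) => y.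
exact: theta_N.
Qed.

Lemma quot_iso_lcs k : 1 <= k -> quot_iso (gammaQ (M_H p) k) (gammaQ (K_free p) k).
Proof.
move=> k0; have tM := @thetaM k.-1; have nK := gammaQ_normal k K_normal.
(* The index is [k.-1] because [gammaF k] is [lcs0 k.-1]; [psi] provides the inverse map. *)
exists (theta k.-1); split=> [x y|]; last split=> [x y|z].
- rewrite -[inv (theta _ _)]/((theta k.-1 x)^-1) -(morphF2V tM).
  rewrite -[mul (theta _ _) _]tM -[mul _ _]/(x^-1 * y); move: (x^-1 * y) => z.
  split=> [|/(gammaQ_hom N_normal psiM (B := K_free p))].
    by apply: (gammaQ_hom K_normal tM) => t; apply: theta_M.
  move=> Kz; apply/(gammaQ_gammaInf _ N_normal k0).
  have nN := gammaQ_normal k N_normal.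
  apply: (cong_sub nN (x := psi (theta k.-1 z))); first exact/gammaQ_lcs/psi_theta.
  by apply: Kz => t /psi_K; apply: gammaQ_in.
- by rewrite [mul x y]/(x * y) tM; apply: (cong_refl nK).
- by exists (psi z); apply/gammaQ_lcs/theta_psi.
Qed.

End Presentations.

(** * Surjective endomorphisms and finite images *)

Lemma lcs_surj_iter n (E : F2 -> F2) : {morph E : x y / x * y} ->
  (forall z, exists x, cong (lcs0 n) (E x) z) ->
  forall i z, exists x, cong (lcs0 n) (iter i E x) z.
Proof.
move=> EM Es i z; have nn := lcs0_normal n.
elim: i z => [|i IH] z; first by exists z; apply: cong_refl.
have [x0 x0z] := Es z; have [x1 x1x0] := IH x0; exists x1.
apply: (cong_trans nn) x0z; rewrite /cong -(morphF2V EM) -EM.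
exact: (lcs0_hom EM).
Qed.

Lemma iterM (E : F2 -> F2) i : {morph E : x y / x * y} ->
  {morph iter i E : x y / x * y}.
Proof. by move=> EM x y; elim: i => //= i ->; rewrite EM. Qed.

(* Precomposition with [E] permutes the finitely many morphisms to [M] that kill [lcs0 n]. *)
Lemma finite_image_periodic (M : finType) (e : M) (op : Monoid.law e)
    (P : F2 -> M) (n : nat) (E : F2 -> F2) :
  {morph P : x y / x * y >-> op x y} -> P 1 = e ->
  (forall x, lcs0 n x -> P x = e) ->
  {morph E : x y / x * y} -> (forall z, exists x, cong (lcs0 n) (E x) z) ->
  exists m, forall z, P z = P (iter m.+1 E z).
Proof.
move=> PM P1 Pn EM Es.
have Pcong x y : cong (lcs0 n) x y -> P x = P y.
  by move=> xy; rewrite -[y in RHS](mulVKg x) PM (Pn _ xy) Monoid.mulm1.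
pose f (i : 'I_(#|{: M * M}|.+1)) :=
  (P (iter i E gen_a), P (iter i E gen_b)).
have [i [j [ltij fij]]] : exists i j : 'I_(#|{: M * M}|.+1), i < j /\ f i = f j.
  case: (boolP (injectiveb f)) => [/injectiveP/leq_card|/injectivePn].
    by rewrite card_ord ltnn.
  case=> i [j nij fij]; case: (ltngtP i j) => [lt|lt|/ord_inj eq].
  - by exists i, j.
  - by exists j, i.
  - by rewrite eq eqxx in nij.
have PE : (fun x => P (iter i E x)) =1 (fun x => P (iter j E x)).
  have hM l : {morph (fun x => P (iter l E x)) : x y / x * y >-> op x y}.
    by move=> x y; rewrite (iterM _ EM) PM.
  have h1 l : P (iter l E 1) = e by rewrite (morphF21 (iterM l EM)).
  by case: fij; apply: F2_hom_eq.
(* Every [z] is some [iter i E x] modulo [lcs0 n], so [E^i] can be cancelled from the equality of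
   [P E^i] and [P E^j]. *)
exists (j - i).-1 => z; rewrite prednK ?subn_gt0 //.
have [x xz] := lcs_surj_iter EM Es i z.
rewrite -(Pcong _ _ xz) [LHS]PE -{1}(subnK (ltnW ltij)) iterD.
apply: Pcong; rewrite /cong -(morphF2V (iterM _ EM)) -(iterM _ EM).
exact: (lcs0_hom (iterM _ EM)).
Qed.

End FreeGroup.

(** * The representation of C_p * C_p *)

Section MagnusRepresentation.
Local Open Scope ring_scope.
Variables (p : nat) (pp : prime p) (oddp : odd p).
Let A := {poly 'F_p}.
Let S := 'M[A]_2.

Let pF : p \in [pchar 'F_p]. Proof. exact: pchar_Fp. Qed.
Let pA : p \in [pchar A]. Proof. by rewrite pchar_poly. Qed.

Lemma morph_expg (h : F2 -> S) : h 1%g = 1 ->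
  {morph h : x y / (x * y)%g >-> x * y} ->
  forall k, {morph h : x / (x ^+ k)%g >-> x ^+ k}.
Proof.
by move=> h1 hM k x; elim: k => [|k IH]; rewrite ?expg0 ?h1 // expgS exprS hM IH.
Qed.

Lemma ker_normal (B : nzRingType) (h : F2 -> B) : h 1%g = 1 ->
  {morph h : x y / (x * y)%g >-> x * y} -> normal_sub (fun x => h x = 1).
Proof.
move=> h1 hM; split=> // [x y|x|x g].
- by rewrite hM => -> ->; rewrite mulr1.
- by move=> hx; rewrite -[LHS]mul1r -{1}hx -hM mulgV.
- by rewrite /conjg !hM => ->; rewrite mul1r -hM mulVg h1.
Qed.

Lemma tr_torsion_image (h : F2 -> S) : h 1%g = 1 ->
  {morph h : x y / (x * y)%g >-> x * y} -> (forall x, \det (h x) = 1) ->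
  (\tr (h gen_a)).[0] = 2%:R ->
  h ((gen_a * [~ gen_b, gen_a]) ^+ p)%g = 1 -> h (gen_b ^+ p)%g = 1 ->
  forall x, \tr (h x) = 2%:R.
Proof.
move=> h1 hM hdet h0 xp yp.
have hV x : h x * h x^-1%g = 1 by rewrite -hM mulgV.
have hR : h (gen_a * [~ gen_b, gen_a])%g =
    h gen_a * (h gen_b^-1%g * h gen_a^-1%g * h gen_b * h gen_a).
  by rewrite hM commgEl /conjg !hM !mulrA.
rewrite (morph_expg h1 hM) hR in xp; rewrite (morph_expg h1 hM) in yp.
have [[mm nn nm] [tm tn tmn]] :=
  mn_rel pF oddp (hV _) (hV _) (hdet _) (hdet _) h0 yp xp.
set m := h gen_a - 1 in mm nm tm tmn; set n := h gen_b - 1 in nn nm tn tmn.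
have hV1 g : (h g - 1) * (h g - 1) = 0 -> h g^-1%g = 1 - (h g - 1).
  move=> sq; have e : (1 - (h g - 1)) * h g = 1.
    by rewrite -{2}[h g](subrK 1) mulrBl mul1r mulrDr sq add0r mulr1 addrAC subrr add0r.
  by rewrite -[LHS]mul1r -{1}e -mulrA hV mulr1.
have ha : h gen_a = 1 + m by rewrite addrC subrK.
have hb : h gen_b = 1 + n by rewrite addrC subrK.
have hbV : h gen_b^-1%g = 1 + (-1) *: n by rewrite hV1 // scaleN1r.
have haV : h gen_a^-1%g = 1 + (-1) *: m by rewrite hV1 // scaleN1r.
clearbody m n.
have mmn : m * (m * n) = 0 by rewrite mulrA mm mul0r.
have nmn : n * (m * n) = 0 by rewrite mulrA nm mulNr -mulrA nn mulr0 oppr0.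
(* The relations between [m] and [n] keep this form stable under left multiplication by the four
   letters [1 + s m], [1 + s n] with [s = 1] or [-1], and [m], [n], [m * n] have trace [0]. *)
suff span x : exists a b c, h x = 1 + a *: m + b *: n + c *: (m * n).
  move=> x; have [a [b [c ->]]] := span x.
  by rewrite !raddfD /= !mxtraceZ tm tn tmn !mulr0 !addr0 mxtrace1.
have mulm (s a b c : A) :
    (1 + s *: m) * (1 + a *: m + b *: n + c *: (m * n)) =
    1 + (a + s) *: m + b *: n + (c + s * b) *: (m * n).
  rewrite !mulrDr mulr1 !mulrDl !mul1r -!scalerAl -!scalerAr mm mmn.
  rewrite !scaler0 !addr0 scalerA !scalerDl -!addrA; congr (1 + _).
  by rewrite addrCA [in LHS](addrC ((s * b) *: _)).
have muln (s a b c : A) :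
    (1 + s *: n) * (1 + a *: m + b *: n + c *: (m * n)) =
    1 + a *: m + (b + s) *: n + (c - s * a) *: (m * n).
  rewrite !mulrDr mulr1 !mulrDl !mul1r -!scalerAl -!scalerAr nn nmn nm.
  rewrite !scaler0 !addr0 !scalerN !scalerA !scalerDl scaleNr -!addrA; congr (1 + _).
  by rewrite addrCA; congr (_ + _); rewrite [- _ + _]addrC -addrA [LHS]addrCA.
rewrite -[m]scale1r in ha; rewrite -[n]scale1r in hb.
elim/F2_gen_ind: x => [|x|x|x|x].
  by exists 0, 0, 0; rewrite h1 !scale0r !addr0.
all: move=> [a [b [c hx]]]; rewrite hM hx ?ha ?hb ?haV ?hbV ?mulm ?muln; eauto.
Qed.

Definition rho_letter (l : letter) : S :=
  1 + (if l.2 then - 'X else 'X) *: (if l.1 then delta_mx 1 0 else delta_mx 0 1).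

Definition rho : F2 -> S := evalF2 ( *%R : Monoid.law (1 : S)) rho_letter.

Lemma delta_sq0 (i j : 'I_2) : i != j ->
  (delta_mx i j : S) * delta_mx i j = 0.
Proof. by move=> ij; rewrite -mulmxE mul_delta_mx_0 // eq_sym. Qed.

Lemma rho_letterV l : rho_letter l * rho_letter (linv l) = 1.
Proof.
case: l => g e; rewrite /rho_letter /=.
set E := (if g then _ else _); have EE : E * E = 0.
  by rewrite /E; case: g {E}; apply: delta_sq0.
rewrite !mulrDr !mulrDl !mulr1 !mul1r -scalerAl -scalerAr EE !scaler0 addr0.
by case: e; rewrite scaleNr ?addrK ?subrK.
Qed.

Lemma rhoM : {morph rho : x y / (x * y)%g >-> x * y}.
Proof. by move=> x y; apply: evalF2M rho_letterV _ _. Qed.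

Lemma rho1 : rho 1%g = 1. Proof. exact: evalF21. Qed.

Lemma rho_a : rho gen_a = 1 + 'X *: delta_mx 0 1.
Proof. by rewrite /rho /evalF2 big_seq1. Qed.

Lemma rho_b : rho gen_b = 1 + 'X *: delta_mx 1 0.
Proof. by rewrite /rho /evalF2 big_seq1. Qed.

Lemma det_rho x : \det (rho x) = 1.
Proof.
rewrite /rho /evalF2; elim: (val x) => [|l s IH]; first by rewrite big_nil det1.
rewrite big_cons -mulmxE det_mulmx IH mulr1 det2E /rho_letter.
by case: l => -[] e /=; rewrite !mxE /=; ring.
Qed.

Lemma rhoV x : rho x * rho x^-1%g = 1.
Proof. by rewrite -rhoM mulgV rho1. Qed.

(** The condition defining the principal congruence subgroup of level [X^n]. *)
Definition cong1 n (M : S) := exists Q, M = 1 + 'X^n *: Q.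

Lemma rho_cong1 x : cong1 1 (rho x).
Proof.
rewrite /rho /evalF2; elim: (val x) => [|l s [Q IH]].
  by exists 0; rewrite big_nil scaler0 addr0.
rewrite big_cons IH /rho_letter /=; set E := (if l.1 then _ else _).
exists (Q + (if l.2 then -1 else 1) *: E
        + (if l.2 then -1 else 1) *: ('X *: (E * Q))).
have -> : (if l.2 then - 'X else 'X : A) = 'X * (if l.2 then -1 else 1).
  by case: l.2; rewrite ?mulrN mulr1.
rewrite mulrDr mulr1 mulrDl mul1r -!addrA; congr (1 + _).
rewrite expr1 !scalerDr -!scalerAl -!scalerAr !scalerA addrCA.
by congr (_ + (_ + _)).
Qed.

(** Commutation adds congruence levels, and the whole image of [rho] already has level [1]; hence
    the shift from [n] to [n.+1]. *)
Lemma rho_lcs n x : lcs0 n x -> cong1 n.+1 (rho x).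
Proof.
elim: n x => [|n IH] x; first by move=> _; apply: rho_cong1.
elim=> {x} [_ [x [y [-> /IH [Y yE]]]]||x y _ [X xE] _ [Y yE]|x _ [X xE]].
- have [X xE] := rho_cong1 x.
  have [V vE] : exists V, V * (rho y * rho x) = 1.
    by exists (rho (y * x)^-1%g); rewrite -!rhoM mulVg rho1.
  exists (V * (X * Y - Y * X)).
  (* Since [y x [x,y] = x y], only the difference of [x y] and [y x] is needed, and no inverse is
     expanded. *)
  have e : rho y * rho x * rho (comm x y) =
           rho y * rho x + 'X^(n.+2) *: (X * Y - Y * X).
    rewrite -!rhoM commE -commgC !rhoM yE xE.
    rewrite !mulrDr !mulrDl !mul1r !mulr1 -!scalerAl -!scalerAr !scalerA.
    rewrite -!exprD addn1 add1n scalerBr -[RHS]addrA [_ - _]addrC.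
    by rewrite [X in _ = _ + X]addrA addrK addrACA.
  by rewrite -[LHS]mul1r -vE -mulrA e mulrDr vE scalerAr.
- by exists 0; rewrite rho1 scaler0 addr0.
- rewrite [mul x y]/(x * y)%g rhoM xE yE; exists (X + Y + 'X^(n.+2) *: (X * Y)).
  rewrite mulrDr mulr1 mulrDl mul1r -!scalerAl -!scalerAr !scalerDr.
  by rewrite -!addrA.
- rewrite [inv x]/(x^-1)%g; exists (- (rho x^-1%g * X)).
  have := rhoV x^-1%g; rewrite invgK xE mulrDr mulr1 -scalerAr scalerN => <-.
  by rewrite addrK.
Qed.

Lemma rho_K x : K_free p x -> rho x = 1.
Proof.
apply: (ncl_sub (ker_normal rho1 rhoM)) => _ [] ->;
  rewrite powE (morph_expg rho1 rhoM) ?rho_a ?rho_b; apply: (unip_exp pA);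
  by rewrite -scalerAl -scalerAr delta_sq0 ?scaler0.
Qed.

Lemma tr_rho_ab : \tr (rho (gen_a * gen_b)%g) = 2%:R + 'X^2.
Proof. by rewrite rhoM rho_a rho_b tr2E !mul2E !mxE /= ; ring. Qed.

Lemma tr_rho0 x : (\tr (rho x)).[0] = 2%:R.
Proof.
have [Q ->] := rho_cong1 x.
rewrite raddfD /= mxtrace1 mxtraceZ expr1 hornerD hornerM hornerX mul0r addr0.
by rewrite -polyC_natr hornerC.
Qed.

(** The common obstruction to Type I, Type II and isomorphism. The values [rho (g x)] supply
    determinant [1] and the trace at [0]; [g] is a mere function because an isomorphism of quotients
    is multiplicative only modulo [K_free p]. *)
Lemma no_surjection_onto_rho (h : F2 -> S) (g : F2 -> F2) :
  (forall x, h x = rho (g x)) ->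
  {morph h : x y / (x * y)%g >-> x * y} ->
  (forall x, M_H p x -> h x = 1) -> (exists x, h x = rho (gen_a * gen_b)%g) ->
  False.
Proof.
move=> hg hM hN [x hx].
have h1 : h 1%g = 1 by apply: hN; apply: (nsub1 (M_normal p)).
have : \tr (h x) = 2%:R.
  apply: tr_torsion_image => // [y|||]; rewrite ?hg ?det_rho ?tr_rho0 // -hg.
  - by apply/hN/gammaInf_in/ncl_in; left; rewrite powE -commE.
  - by apply/hN/gammaInf_in/ncl_in; right; rewrite powE.
rewrite hx tr_rho_ab -[RHS]addr0 => /addrI /eqP.
by rewrite expf_eq0 polyX_eq0.
Qed.

(** * Finite truncations of the representation and Type I *)

Lemma rho_mod_inj x :
  (forall n, map_mx (in_qpoly 'X^(n.+1)) (rho x) = 1) -> rho x = 1.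
Proof.
move=> rx; apply/eqP; rewrite -subr_eq0; apply/eqP/matrixP => i j; rewrite [RHS]mxE.
set q := (rho x - 1) i j; have [//|q0] := eqVneq q 0.
(* At this precision [q] is its own reduction, so a zero reduction contradicts [q != 0]. *)
pose n := size q; have : in_qpoly 'X^(n.+1) q = 0.
  have e : in_qpoly 'X^(n.+1) (rho x i j) = (i == j)%:R.
    by have /matrixP/(_ i j) := rx n; rewrite !mxE.
  have -> : q = rho x i j - (i == j)%:R by rewrite /q !mxE.
  by rewrite raddfB /= e rmorph_nat subrr.
move/(congr1 (@polyn _ _)); rewrite in_qpoly_small; first by move/eqP; rewrite (negbTE q0).
by rewrite mk_monic_Xn size_polyXn.
Qed.

Let Sn n := 'M[{poly %/ ('X^(n.+1) : A)}]_2.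

(** Truncation makes the target finite, as [finite_image_periodic] demands, and the exponent [n.+1]
    is the level that [rho_lcs] gives on [lcs0 n]. *)
Definition rho_mod n (x : F2) : Sn n := map_mx (in_qpoly 'X^(n.+1)) (rho x).

Lemma rho_modM n : {morph rho_mod n : x y / (x * y)%g >-> x * y}.
Proof. by move=> x y; rewrite /rho_mod rhoM -!mulmxE map_mxM. Qed.

Lemma rho_mod1 n : rho_mod n 1%g = 1.
Proof. by rewrite /rho_mod rho1 map_mx1. Qed.

Lemma rho_mod_lcs n x : lcs0 n x -> rho_mod n x = 1.
Proof.
move=> /rho_lcs[Q xQ]; rewrite /rho_mod xQ map_mxD map_mx1 map_mxZ /=.
suff -> : in_qpoly 'X^(n.+1) 'X^(n.+1) = 0 :> {poly %/ ('X^(n.+1) : A)}.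
  by rewrite scale0r addr0.
by apply: val_inj; rewrite /= mk_monic_Xn Pdiv.RingMonic.rmodpp ?monicXn.
Qed.

Lemma rho_automorphism_M phi : automorphism phi ->
  subset (K_free p) (image phi (M_H p)) ->
  forall r, M_H p r -> rho (phi r) = 1.
Proof.
move=> [phiM [phi' phiK phi'K]] sub r Mr; apply: rho_mod_inj => n.
have phi'M : {morph phi' : x y / (x * y)%g}.
  move=> x y; apply: (can_inj phiK).
  by rewrite [RHS]phiM !phi'K.
pose E x := theta n (phi' x); have EM : {morph E : x y / (x * y)%g}.
  by move=> x y; rewrite /E phi'M thetaM.
have Esurj z : exists x, cong (lcs0 n) (E x) z.
  by exists (phi (psi z)); rewrite /E phiK; apply: theta_psi.
have [m Pm] := @finite_image_periodic (Sn n) 1 *%R _ n E (@rho_modM n)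
  (rho_mod1 n) (@rho_mod_lcs n) EM Esurj.
have MQ s : M_H p s -> gammaQ (K_free p) n.+1 (E (phi s)).
  by move=> Ms; rewrite /E phiK; apply: (@theta_M p n.+1).
(* The inclusion of [K] in [phi(M)] enters here: it makes [E] act on the quotient by
   [gammaQ (K_free p) n.+1]. *)
have KQ x : gammaQ (K_free p) n.+1 x -> gammaQ (K_free p) n.+1 (E x).
  by apply: (gammaQ_hom (K_normal p) EM) => y /sub[s Ms <-]; apply: MQ.
(* By periodicity [phi r] may be replaced by an iterated image under [E]; the first application
   already lands in [gammaQ (K_free p) n.+1], which [rho_mod n] kills. *)
rewrite -/(rho_mod n _) Pm iterSr.
have : gammaQ (K_free p) n.+1 (iter m E (E (phi r))).
  by elim: m {Pm} => [|m IH]; [apply: MQ | apply: KQ].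
apply: (sgen_sub (ker_normal (rho_mod1 n) (@rho_modM n))) => y [|/rho_K yK].
  exact: rho_mod_lcs.
by rewrite /rho_mod yK map_mx1.
Qed.

End MagnusRepresentation.

Theorem mainTheorem13 (p : nat) (hp : prime p) (hodd : odd p) :
  para (M_H p) (K_free p) /\ typeIII (M_H p) (K_free p) /\
  res_nilp (M_H p) /\
  (forall i, 1 <= i -> quot_iso (gammaQ (M_H p) i) (gammaQ (K_free p) i)) /\
  ~ quot_iso (M_H p) (K_free p).
Proof.
have wp := @quot_iso_lcs p.
have rn : res_nilp (M_H p) := gammaInf_res_nilp (N_normal p).
split; first by [].
split; last split=> //; last split=> //.
- split=> //; split=> -[phi].
  + move=> [aut sub]; have [phiM [phi' _ phi'K]] := aut.
    apply: (no_surjection_onto_rho hp hodd (h := fun x => rho p (phi x)) (g := phi)).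
    * by [].
    * by move=> x y; rewrite [phi _]phiM rhoM.
    * exact: rho_automorphism_M.
    * by exists (phi' (gen_a * gen_b)%g); rewrite phi'K.
  + move=> [[phiM [phi' _ phi'K]] [sub _]].
    apply: (no_surjection_onto_rho hp hodd (h := fun x => rho p (phi x)) (g := phi)).
    * by [].
    * by move=> x y; rewrite [phi _]phiM rhoM.
    (* Here [phi(M)] lies in [K], which [rho] kills. *)
    * by move=> x Mx; apply: rho_K => //; apply: sub; exists x.
    * by exists (phi' (gen_a * gen_b)%g); rewrite phi'K.
- move=> [f [fAB [fM fsurj]]].
  (* [rho] kills the defect of multiplicativity of [f], so [rho] after [f] is a genuine morphism. *)
  have rhoE x y : K_free p (mul (inv x) y) -> rho p x = rho p y.
    move=> /(rho_K hp) e; rewrite -[y](mulVKg x) rhoM.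
    by rewrite [rho p (_ * y)%g]e GRing.mulr1.
  have hM : {morph (fun x => rho p (f x)) : x y / (x * y)%g >-> (x * y)%R}.
    by move=> x y; rewrite -rhoM; apply/esym/rhoE/fM.
  (* [f 1] may differ from [1], but its image is idempotent and invertible. *)
  have h1 : rho p (f 1%g) = 1%R.
    have /= e := hM 1%g 1%g; rewrite mulg1 in e.
    by move: (rhoV p (f 1%g)); rewrite {1}e -GRing.mulrA rhoV GRing.mulr1.
  apply: (no_surjection_onto_rho hp hodd (h := fun x => rho p (f x)) (g := f)) => //.
  + move=> x Mx; rewrite -h1; apply/esym/rhoE/fAB.
    by rewrite -[mul _ _]/(1^-1 * x)%g invg1 mul1g.
  + have [x xz] := fsurj (gen_a * gen_b)%g; exists x; exact: rhoE.
Qed.
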